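(* Let $h:\mathbb R^n\to\mathbb R$ be a Legendre kernel with full domain ($C:=\operatorname{int}\operatorname{dom}h=\mathbb R^n$), let $f:\mathbb R^n\to\mathbb R$ be $L_f$-smooth relative to $h$, let $g:\mathbb R^n\to\mathbb R\cup\{\infty\}$ be proper and lsc, and let $\varphi=f+g$ satisfy $\operatorname*{argmin}\varphi\ne\emptyset$. Let $\gamma\in(0,1/L_f)$ and $\sigma\in(0,\frac{1-\gamma L_f}{\gamma})$, and consider the iterates $(x^k),(\bar x^k)$ generated by the algorithm Bella with tolerance $\varepsilon=0$, assuming $\bar x^k\ne x^k$ for all $k$. Suppose that $\varphi$ is level bounded. Then $(x^k)$ and $(\bar x^k)$ have the same set of limit points $\omega$, which is compact and such that $\operatorname{dist}(x^k,\omega)\to0$ and $\operatorname{dist}(\bar x^k,\omega)\to0$ as $k\to\infty$. Moreover, every $x_\star\in\omega$ satisfies the fixed-point inclusion $x_\star\in T_\gamma(x_\star)$, and in particular is stationary for $\varphi$. Finally, $\varphi$ is constant on $\omega$, equal to the common (finite) limit $\varphi_\star$ of the sequences $(\varphi(\bar x^k))$ and $(\Phi_\gamma(x^k))$.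
   Context: A Legendre kernel is a proper, lsc, convex function $h$ with $\operatorname{int}\operatorname{dom}h\ne\emptyset$, $\mathcal C^1$ on $\operatorname{int}\operatorname{dom}h$, strictly convex, essentially smooth ($\|\nabla h(x_k)\|\to\infty$ whenever $\operatorname{int}\operatorname{dom}h\ni x_k$ converges to a boundary point of $\operatorname{dom}h$; void for full domain), and $1$-coercive ($\lim_{\|x\|\to\infty}h(x)/\|x\|=\infty$). Bregman distance: $\mathrm D_h(x,y)=h(x)-h(y)-\langle\nabla h(y),x-y\rangle$. $f$ is $L_f$-smooth relative to $h$ ($L_f\ge0$) if $L_fh\pm f$ are convex (on $\operatorname{int}\operatorname{dom}h=\mathbb R^n$); $1/L_f:=\infty$ if $L_f=0$. Bregman forward-backward map and envelope: $T_\gamma(x)=\operatorname*{argmin}_z\{f(x)+\langle\nabla f(x),z-x\rangle+g(z)+\frac1\gamma \mathrm D_h(z,x)\}$, and $\Phi_\gamma(x)$ is the infimum of the same expression over $z\in\mathbb R^n$. Algorithm Bella. Input: $\gamma\in(0,1/L_f)$, $x^0\in C$, $\sigma\in(0,\frac{1-\gamma L_f}\gamma)$, tolerance $\varepsilon\ge0$, $i_{\max}\in\mathbb N\cup\{\infty\}$. For $k=0,1,\dots$: (1) choose $\bar x^k\in T_\gamma(x^k)$; (2) if $\mathrm D_h(\bar x^k,x^k)\le\varepsilon$, stop and return $\bar x^k$; (3) choose any $d^k\in\mathbb R^n$; (4) for $i=0,1,2,\dots$ let $\tau_k=2^{-i}$ and $x^{k+1}=(1-\tau_k)\bar x^k+\tau_k(x^k+d^k)$,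 and accept $x^{k+1}$ at the first $i$ for which $\Phi_\gamma(x^{k+1})\le\Phi_\gamma(x^k)-\sigma \mathrm D_h(\bar x^k,x^k)$; if this inequality fails for $i=i_{\max}$, set instead $x^{k+1}=\bar x^k$. Level bounded: all sublevel sets are bounded. Stationary: $0\in\partial\varphi(x_\star)$, with $\partial$ the limiting (Mordukhovich) subdifferential. *)

(* Defs.v *)
From HB Require Import structures.
From mathcomp Require Import all_boot all_order all_algebra.
From mathcomp Require Import all_classical all_reals all_analysis.

Set Implicit Arguments.
Unset Strict Implicit.
Unset Printing Implicit Defensive.

Import Order.TTheory GRing.Theory Num.Theory.
Import numFieldNormedType.Exports.

Local Open Scope classical_set_scope.
Local Open Scope ring_scope.

(* The norm that the library puts on row vectors is the sup norm; its topology
   is the Euclidean one, and the Euclidean norm itself is [enorm]. *)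
Definition dot (R : realType) (n : nat) (u v : 'rV[R]_n) : R :=
  \sum_(i < n) u 0 i * v 0 i.

Definition enorm (R : realType) (n : nat) (u : 'rV[R]_n) : R :=
  Num.sqrt (dot u u).

(* Extended-valued, so that the distance to the empty set is [+oo]. *)
Definition edist_set (R : realType) (n : nat) (x : 'rV[R]_n)
    (A : set 'rV[R]_n) : \bar R :=
  ereal_inf [set (enorm (x - y))%:E | y in A].

Definition grad (R : realType) (n : nat) (f : 'rV[R]_n -> R) (x : 'rV[R]_n)
    : 'rV[R]_n :=
  \row_(i < n) 'D_(delta_mx 0 i) f x.

Definition edom (R : realType) (T : Type) (F : T -> \bar R) : set T :=
  [set x | (F x < +oo)%E].

Definition eproper (R : realType) (T : Type) (F : T -> \bar R) : Prop :=
  (forall x, F x != -oo%E) /\ edom F !=set0.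

Definition argmin (R : realType) (T : Type) (F : T -> \bar R) : set T :=
  [set x | forall y, (F x <= F y)%E].

Definition econvex (R : realType) (n : nat) (F : 'rV[R]_n -> \bar R) : Prop :=
  forall (x y : 'rV[R]_n) (t : R), 0 < t < 1 ->
    (F (t *: x + (1 - t) *: y)%R <= t%:E * F x + (1 - t)%:E * F y)%E.

Definition strictly_econvex (R : realType) (n : nat)
    (F : 'rV[R]_n -> \bar R) : Prop :=
  forall (x y : 'rV[R]_n) (t : R), edom F x -> edom F y -> x != y ->
    0 < t < 1 ->
    (F (t *: x + (1 - t) *: y)%R < t%:E * F x + (1 - t)%:E * F y)%E.

Definition C1_int_dom (R : realType) (n : nat)
    (F : 'rV[R]_n -> \bar R) : Prop :=
  forall x, (edom F)° x ->
    differentiable (fine \o F) x /\ {for x, continuous (grad (fine \o F))}.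

Definition essentially_smooth (R : realType) (n : nat)
    (F : 'rV[R]_n -> \bar R) : Prop :=
  forall (u : nat -> 'rV[R]_n) (p : 'rV[R]_n),
    (forall k, (edom F)° (u k)) ->
    (closure (edom F) `\` (edom F)°) p ->
    u @ \oo --> p ->
    (fun k => enorm (grad (fine \o F) (u k))) @ \oo --> +oo.

Definition coercive1 (R : realType) (n : nat)
    (F : 'rV[R]_n -> \bar R) : Prop :=
  forall M : R, exists r : R, forall x : 'rV[R]_n, r < enorm x ->
    (M%:E < F x * ((enorm x)^-1)%:E)%E.

Record legendre_kernel (R : realType) (n : nat)
    (F : 'rV[R]_n -> \bar R) : Prop := LegendreKernel {
  legendre_proper : eproper F;
  legendre_lsc : lower_semicontinuous F;
  legendre_convex : econvex F;
  legendre_int_dom : (edom F)° !=set0;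
  legendre_C1 : C1_int_dom F;
  legendre_strict : strictly_econvex F;
  legendre_ess_smooth : essentially_smooth F;
  legendre_coercive : coercive1 F
}.

Definition bregman (R : realType) (n : nat) (h : 'rV[R]_n -> R)
    (x y : 'rV[R]_n) : R :=
  h x - h y - dot (grad h y) (x - y).

Definition rel_smooth (R : realType) (n : nat) (L : R)
    (h f : 'rV[R]_n -> R) : Prop :=
  [/\ 0 <= L,
      convex_function (E := 'rV[R]_n) setT (fun z => L * h z + f z) &
      convex_function (E := 'rV[R]_n) setT (fun z => L * h z - f z)].

Definition bfb_model (R : realType) (n : nat) (h f : 'rV[R]_n -> R)
    (g : 'rV[R]_n -> \bar R) (gamma : R) (x z : 'rV[R]_n) : \bar R :=
  ((f x + dot (grad f x) (z - x))%:E + g z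
    + (gamma^-1 * bregman h z x)%:E)%E.

Definition bfb_map (R : realType) (n : nat) (h f : 'rV[R]_n -> R)
    (g : 'rV[R]_n -> \bar R) (gamma : R) (x : 'rV[R]_n) : set 'rV[R]_n :=
  argmin (bfb_model h f g gamma x).

Definition bfb_env (R : realType) (n : nat) (h f : 'rV[R]_n -> R)
    (g : 'rV[R]_n -> \bar R) (gamma : R) (x : 'rV[R]_n) : \bar R :=
  ereal_inf (range (bfb_model h f g gamma x)).

Definition ls_point (R : realType) (n : nat) (x xb d : 'rV[R]_n) (i : nat)
    : 'rV[R]_n :=
  (1 - 2^-1 ^+ i) *: xb + 2^-1 ^+ i *: (x + d).

Definition ls_accept (R : realType) (n : nat) (h f : 'rV[R]_n -> R)
    (g : 'rV[R]_n -> \bar R) (gamma sigma : R)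
    (x xb d : 'rV[R]_n) (i : nat) : Prop :=
  (bfb_env h f g gamma (ls_point x xb d i)
    <= bfb_env h f g gamma x - (sigma * bregman h xb x)%:E)%E.

(* [imax = None] stands for an infinite [imax]. *)
Definition ls_step (R : realType) (n : nat) (h f : 'rV[R]_n -> R)
    (g : 'rV[R]_n -> \bar R) (gamma sigma : R) (imax : option nat)
    (x xb d xnext : 'rV[R]_n) : Prop :=
  (exists i : nat,
    [/\ if imax is Some m then (i <= m)%N else True,
        ls_accept h f g gamma sigma x xb d i,
        forall j, (j < i)%N -> ~ ls_accept h f g gamma sigma x xb d j &
        xnext = ls_point x xb d i])
  \/
  (exists m : nat,
    [/\ imax = Some m,
        forall j, (j <= m)%N -> ~ ls_accept h f g gamma sigma x xb d j &
        xnext = xb]).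

(* Iteration [k] is performed if the stopping test failed at all earlier ones;
   after termination the sequences are unconstrained. *)
Definition bella (R : realType) (n : nat) (h f : 'rV[R]_n -> R)
    (g : 'rV[R]_n -> \bar R) (gamma sigma eps : R) (imax : option nat)
    (x xb : nat -> 'rV[R]_n) : Prop :=
  forall k : nat,
    (forall j, (j < k)%N -> ~ (bregman h (xb j) (x j) <= eps)) ->
    bfb_map h f g gamma (x k) (xb k) /\
    (~ (bregman h (xb k) (x k) <= eps) ->
      exists d : 'rV[R]_n,
        ls_step h f g gamma sigma imax (x k) (xb k) d (x k.+1)).

Definition level_bounded (R : realType) (n : nat)
    (F : 'rV[R]_n -> \bar R) : Prop :=
  forall a : R, bounded_set [set x | (F x <= a%:E)%E].

(* F z >= F x + <v, z - x> + o(|z - x|) as z tends to x, where F x is finite *)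
Definition regular_subdiff (R : realType) (n : nat)
    (F : 'rV[R]_n -> \bar R) (x : 'rV[R]_n) : set 'rV[R]_n :=
  [set v | F x \is a fin_num /\
    forall e : R, 0 < e -> \forall z \near x,
      (F x + (dot v (z - x) - e * enorm (z - x))%:E <= F z)%E].

Definition limiting_subdiff (R : realType) (n : nat)
    (F : 'rV[R]_n -> \bar R) (x : 'rV[R]_n) : set 'rV[R]_n :=
  [set v | F x \is a fin_num /\
    exists xs vs : nat -> 'rV[R]_n,
      [/\ xs @ \oo --> x,
          F \o xs @ \oo --> F x,
          forall k, regular_subdiff F (xs k) (vs k) &
          vs @ \oo --> v]].

Definition stationary (R : realType) (n : nat)
    (F : 'rV[R]_n -> \bar R) (x : 'rV[R]_n) : Prop :=
  limiting_subdiff F x 0.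

(* Main.v *)
(* Relative smoothness puts the forward-backward model at [x] between
   [phi + (1/gamma - L) D_h(., x)] and [phi + (1/gamma + L) D_h(., x)]. Hence
   the full step [xb k] passes the acceptance test, the envelope decreases by
   at least [sigma D_h(xb k, x k)] along the run, and these distances tend to 0.
   By strict convexity [D_h] is bounded away from 0 on pairs of points at
   distance at least [d] whose first component stays in a ball, so [x k - xb k]
   tends to 0 and the two sequences share their limit points. There, lower
   semicontinuity passes [phi (xb k) <= model (x k) z] to the limit, giving the
   fixed-point inclusion; at a fixed point [y] the upper bound yields
   [phi z >= phi y - (1/gamma + L) D_h(z, y)], and [D_h(z, y) = o(|z - y|)], so
   0 is even a regular subgradient. *)
Require Import Defs.
From HB Require Import structures.
From mathcomp Require Import all_boot all_order all_algebra.
From mathcomp Require Import all_classical all_reals all_analysis.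
From mathcomp Require Import ring lra.
Import Order.TTheory GRing.Theory Num.Theory.
Import numFieldNormedType.Exports.
Local Open Scope classical_set_scope.
Local Open Scope ring_scope.
Set Implicit Arguments.
Unset Strict Implicit.

(** * Convex functions: gradient inequality and differentiability of summands *)

Section Convex.
Variables (R : realType) (n : nat).
Implicit Types (F P Q : 'rV[R]_n -> R) (u v w x y z : 'rV[R]_n).

Lemma dotDr u v w : dot u (v + w) = dot u v + dot u w.
Proof.
by rewrite /dot -big_split /=; apply: eq_bigr => i _; rewrite mxE mulrDr.
Qed.

Lemma dotDl u v w : dot (v + w) u = dot v u + dot w u.
Proof.
by rewrite /dot -big_split /=; apply: eq_bigr => i _; rewrite mxE mulrDl.
Qed.

Lemma dotZr (a : R) u v : dot u (a *: v) = a * dot u v.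
Proof.
by rewrite /dot mulr_sumr; apply: eq_bigr => i _; rewrite mxE mulrCA.
Qed.

Lemma dotZl (a : R) u v : dot (a *: u) v = a * dot u v.
Proof.
by rewrite /dot mulr_sumr; apply: eq_bigr => i _; rewrite mxE mulrA.
Qed.

Lemma dotBl u v w : dot (v - w) u = dot v u - dot w u.
Proof. by rewrite dotDl -scaleN1r dotZl mulN1r. Qed.

Lemma dot0r u : dot u 0 = 0.
Proof. by rewrite -(scale0r 0) dotZr mul0r. Qed.

Lemma dot0l u : dot 0 u = 0.
Proof. by rewrite -(scale0r 0) dotZl mul0r. Qed.

Lemma cvg_dot (T : Type) (G : set_system T) {GG : Filter G}
    (p q : T -> 'rV[R]_n) u v :
  p @ G --> u -> q @ G --> v -> dot (p t) (q t) @[t --> G] --> dot u v.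
Proof.
move=> pu qv; rewrite /dot.
apply: (@cvg_big R^o 'I_n +%R 0 xpredT _ T G _ (fun i t => p t 0 i * q t 0 i)
  (fun i => u 0 i * v 0 i)); first exact: add_continuous.
move=> i _; apply: cvgM.
  exact: (cvg_comp _ _ pu (@coord_continuous R 1 n 0 i u)).
exact: (cvg_comp _ _ qv (@coord_continuous R 1 n 0 i v)).
Qed.

Lemma dot_delta u (i : 'I_n) : dot u (delta_mx 0 i) = u 0 i.
Proof.
rewrite /dot (bigD1 i)//= big1 ?addr0 ?mxE ?eqxx ?mulr1// => j ji.
by rewrite mxE (negbTE ji) andbF mulr0.
Qed.

(** Plain real weights, strictly between 0 and 1: the common form to which the convexity of [h] and
    of [L h + f], [L h - f] is reduced. *)
Definition convex_fct F :=
  forall x y (t : R), 0 < t < 1 ->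
    F (t *: x + (1 - t) *: y) <= t * F x + (1 - t) * F y.

Lemma convex_fct_mid F x y : convex_fct F ->
  F (2^-1 *: (x + y)) <= (F x + F y) / 2.
Proof.
move=> cF; have := cF x y 2^-1.
rewrite (_ : 1 - 2^-1 = 2^-1 :> R); last by lra.
rewrite scalerDr => /(_ _)/le_trans; apply; [lra|].
lra.
Qed.

(** Clearing the denominator makes the bound trivial at [t = 0], so it holds on a full neighbourhood
    instead of a punctured one. *)
Lemma derivable_quot_le F x v : derivable F x v ->
  forall e : R, 0 < e ->
    \forall t \near (0 : R), `|F (t *: v + x) - F x - t * 'D_v F x| <= e * `|t|.
Proof.
move=> dF e e0.
have /cvgrPdist_le/(_ e e0) := dF.
rewrite near_withinE => H.
near=> t.
have [->|t0] := eqVneq t 0.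
  by rewrite scale0r add0r subrr mul0r subr0 normr0 mulr0.
have -> : F (t *: v + x) - F x - t * 'D_v F x
    = - (('D_v F x - t^-1 * (F (t *: v + x) - F x)) * t) by field.
rewrite normrN normrM ler_wpM2r//.
by move: t0; near: t; exact: H.
Unshelve. all: end_near. Qed.

Lemma near0_scale (P : R -> Prop) (c : R) :
  (\forall t \near (0 : R), P t) -> \forall t \near (0 : R), P (c * t).
Proof.
have : c * t @[t --> (0 : R)] --> (0 : R).
  rewrite -[X in _ --> X](mulr0 c); exact: mulrl_continuous.
by move=> cc /cc.
Qed.

(* The increments [F (x + t u) - F x - t <grad F x, u>] are bounded above by
   [o(t)] for every [u]: this holds on the axes, and by midpoint convexity it
   passes to sums. Convexity then turns the upper bound into a lower one. *)
Lemma convex_grad_ineq F x z : convex_fct F ->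
  (forall i, derivable F x (delta_mx 0 i)) ->
  F x + dot (grad F x) (z - x) <= F z.
Proof.
move=> cF dF.
pose phi u := F (u + x) - F x - dot (grad F x) u.
have phi0 : phi 0 = 0 by rewrite /phi add0r subrr dot0r subr0.
have cphi : convex_fct phi.
  move=> u v t t01.
  have := cF (u + x) (v + x) t t01; rewrite /phi dotDr !dotZr.
  rewrite (_ : t *: (u + x) + (1 - t) *: (v + x)
    = t *: u + (1 - t) *: v + x); first by lra.
  by rewrite !scalerDr addrACA -(scalerDl x) [t + _]addrC subrK scale1r.
pose V u := forall e : R, 0 < e ->
  \forall t \near (0 : R), phi (t *: u) <= e * `|t|.
have VD u v : V u -> V v -> V (u + v).
  move=> Vu Vv e e0.
  have e20 : 0 < e / 2 by rewrite divr_gt0.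
  near=> t.
  (* The midpoint of [2 t u] and [2 t v] is [t (u + v)]. *)
  have := convex_fct_mid ((2 * t) *: u) ((2 * t) *: v) cphi.
  rewrite -scalerDr scalerA mulrA mulVf// mul1r => /le_trans; apply.
  have -> : e * `|t| = (e / 2 * `|2 * t| + e / 2 * `|2 * t|) / 2.
    by rewrite normrM ger0_norm//; lra.
  rewrite ler_pM2r ?invr_gt0// lerD//; near: t.
    exact: (near0_scale (P := fun s => phi (s *: u) <= _ * `|s|) 2 (Vu _ e20)).
  exact: (near0_scale (P := fun s => phi (s *: v) <= _ * `|s|) 2 (Vv _ e20)).
have VZ a u : V u -> V (a *: u).
  move=> Vu e e0; near=> t; rewrite scalerA mulrC.
  have a0 : 0 < `|a| + 1 by rewrite ltr_wpDl.
  apply: (@le_trans _ _ (e / (`|a| + 1) * `|a * t|)); last first.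
    rewrite normrM mulrA ler_wpM2r// mulrAC ler_pdivrMr// ler_wpM2l ?(ltW e0)//.
    by rewrite lerDl.
  near: t.
  apply: (near0_scale (P := fun s => phi (s *: u) <= _ * `|s|)).
  by apply: Vu; rewrite divr_gt0.
have Vdelta i : V (delta_mx 0 i).
  move=> e e0; near=> t.
  have : `|F (t *: delta_mx 0 i + x) - F x - t * 'D_(delta_mx 0 i) F x|
      <= e * `|t|.
    by near: t; exact: derivable_quot_le.
  move=> /(le_trans (ler_norm _)); rewrite /phi dotZr.
  by rewrite dot_delta mxE.
have Vall u : V u.
  rewrite (row_sum_delta u); elim/big_ind: _ => //; last by move=> i _; apply: VZ.
  by move=> e e0; near=> t; rewrite scaler0 phi0 mulr_ge0// ltW.
suff : 0 <= phi (z - x) by rewrite /phi subrK; lra.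
apply/ler_addgt0Pr => e e0.
have /nbhs_ballP[d /= d0 dP] := Vall (z - x) e e0.
pose t := Num.min (d / 2) 2^-1.
have t0 : 0 < t by rewrite lt_min divr_gt0//= invr_gt0.
have t1 : t <= 2^-1 by rewrite ge_min lexx orbT.
have td : t < d by rewrite gt_min (_ : d / 2 < d)//; lra.
have /dP : ball (0 : R) d (- t) by rewrite /ball/= sub0r opprK gtr0_norm.
rewrite normrN gtr0_norm// => tle.
(* With [w = z - x]: as [0] is the midpoint of [t w] and [- t w], [phi (t w) >= - e t]; convexity
   between [w] and [0] gives [phi (t w) <= t phi w]. Hence [phi w >= - e]. *)
have := convex_fct_mid (t *: (z - x)) (- t *: (z - x)) cphi.
rewrite -scalerDl subrr scale0r scaler0 phi0 => mid.
have := cphi (z - x) 0 t; rewrite t0 (_ : t < 1) /=; last by lra.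
move=> /(_ isT); rewrite scaler0 addr0 phi0 mulr0 addr0 => tphi.
rewrite -(@ler_pM2l _ t)// mulr0 mulrDr; lra.
Unshelve. all: end_near. Qed.

(* A slope of a convex function is nondecreasing, so in the difference of the
   slopes of [P + Q] at [t] and [-t], which tends to 0, the contributions of [P]
   and of [Q] are nonnegative and both tend to 0. *)
Lemma convex_summand_derivable P Q x v : convex_fct P -> convex_fct Q ->
  derivable (fun z => P z + Q z) x v -> derivable P x v.
Proof.
move=> cP cQ dPQ.
pose S F t := t^-1 * (F (t *: v + x) - F x).
have slope F s t : convex_fct F -> 0 < s -> 0 < t -> S F (- s) <= S F t.
  move=> cF s0 t0.
  have st0 : 0 < s + t by rewrite addr_gt0.
  (* This weight makes [x] the convex combination of [x - s v] and [x + t v]. *)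
  have := cF (- s *: v + x) (t *: v + x) (t / (s + t)).
  have t01 : 0 < t / (s + t) < 1 by rewrite divr_gt0//= ltr_pdivrMr// mul1r ltrDr.
  move=> /(_ t01).
  have -> : 1 - t / (s + t) = s / (s + t) by field; rewrite gt_eqF.
  rewrite !scalerDr !scalerA addrACA -(scalerDl v) -(scalerDl x).
  have -> : t / (s + t) * - s + s / (s + t) * t = 0 by field; rewrite gt_eqF.
  have -> : t / (s + t) + s / (s + t) = 1 by field; rewrite gt_eqF.
  rewrite scale0r scale1r add0r => H.
  rewrite /S invrN mulNr -mulrN opprB -subr_ge0.
  have -> : t^-1 * (F (t *: v + x) - F x) - s^-1 * (F x - F (- s *: v + x))
    = ((t / (s + t) * F (- s *: v + x) + s / (s + t) * F (t *: v + x)) - F x)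
      * ((s + t) / (s * t)).
    by field; rewrite !gt_eqF.
  by rewrite mulr_ge0 ?subr_ge0// divr_ge0 ?mulr_ge0 ?ltW.
(* The derivative will be the supremum [a] of the left slopes. It separates left slopes from right
   ones, so both are near [a] once they are near each other. *)
pose A := [set S P (- s) | s in [set s | 0 < s]].
have Aub t : 0 < t -> ubound A (S P t).
  by move=> t0 _ [s /= s0 <-]; exact: slope.
have Asup : has_sup A.
  split; first by exists (S P (- 1)), 1 => //=.
  by exists (S P 1); exact: Aub.
pose a := sup A.
have ale t : 0 < t -> a <= S P t.
  by move=> t0; apply: ge_sup; [case: Asup|exact: Aub].
have lea t : 0 < t -> S P (- t) <= a.
  by move=> t0; apply: ub_le_sup; [case: Asup|exists t].
have /cvg_ex[l /cvgrPdist_le dl] := dPQ.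
apply/cvg_ex; exists a; apply/cvgrPdist_le => e e0.
have e20 : 0 < e / 2 by rewrite divr_gt0.
have := dl _ e20; rewrite !near_withinE => /nbhs_ballP[d /= d0 dP].
apply/nbhs_ballP; exists d => //= t td t0.
have main s : 0 < s -> s < d -> S P s - S P (- s) <= e.
  move=> s0 sd.
  have E r : r^-1 *: (P (r *: v + x) + Q (r *: v + x) - (P x + Q x))
      = S P r + S Q r.
    by rewrite /S /GRing.scale/=; lra.
  have /dP : ball (0 : R) d s by rewrite /ball/= sub0r normrN gtr0_norm.
  rewrite gt_eqF// => /(_ isT); rewrite E => Hp.
  have /dP : ball (0 : R) d (- s) by rewrite /ball/= sub0r opprK gtr0_norm.
  rewrite oppr_eq0 gt_eqF// => /(_ isT); rewrite E => Hm.
  have := slope Q s s cQ s0 s0.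
  move: Hp Hm; rewrite !ler_norml; lra.
change (`|a - S P t| <= e).
move: td; rewrite /ball/= sub0r normrN => td.
have [t_gt0|t_lt0|t_eq0] := ltgtP 0 t; last by rewrite t_eq0 eqxx in t0.
- rewrite gtr0_norm// in td.
  have := main t t_gt0 td; have := ale t t_gt0; have := lea t t_gt0.
  rewrite ler_norml; lra.
- rewrite ltr0_norm// in td.
  have nt : 0 < - t by rewrite oppr_gt0.
  have := main _ nt td; have := ale _ nt; have := lea _ nt.
  rewrite opprK ler_norml; lra.
Qed.

End Convex.

(** * Bregman distances and smoothness relative to the kernel *)

Section Bregman.
Variables (R : realType) (n : nat).
Implicit Types (u v w x y z : 'rV[R]_n).
Variable h : 'rV[R]_n -> R.
Hypothesis h_convex : convex_fct h.
Hypothesis h_diff : forall x, differentiable h x.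
Hypothesis h_grad : continuous (grad h).

Lemma bregman_ge0 z x : 0 <= bregman h z x.
Proof.
have := @convex_grad_ineq R n h x z h_convex.
move=> /(_ (fun i => diff_derivable (h_diff x))).
rewrite /bregman; lra.
Qed.

(** Adding the gradient inequalities between [z + s w] and [z + w] shows that the slope of [h] along
    [w] is at least as large at [z + w]. This lets a distant second argument be pulled back towards
    [z]. *)
Lemma bregman_segment z w (s : R) : 0 <= s <= 1 ->
  bregman h z (z + s *: w) <= bregman h z (z + w).
Proof.
move=> s01; have [->|s1] := eqVneq s 1; first by rewrite scale1r.
have := bregman_ge0 (z + s *: w) (z + w).
have := bregman_ge0 (z + w) (z + s *: w).
rewrite /bregman.
have E a : z - (z + a) = (- 1) *: a by rewrite opprD addNKr scaleN1r.
have -> : z + s *: w - (z + w) = (s - 1) *: w.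
  by rewrite opprD addrACA subrr add0r scalerBl scale1r.
have -> : z + w - (z + s *: w) = (1 - s) *: w.
  by rewrite opprD addrACA subrr add0r scalerBl scale1r.
rewrite !E !dotZr.
set A := dot (grad h (z + s *: w)) w; set B := dot (grad h (z + w)) w.
move=> H1 H2.
have AB : 0 <= (B - A) * (1 - s) by lra.
have sl : s < 1 by rewrite lt_neqAle s1; lra.
have : 0 <= B - A by move: AB; rewrite pmulr_lge0// subr_gt0.
move=> BA; have : 0 <= s * (B - A) by rewrite mulr_ge0//; lra.
lra.
Qed.

Lemma cvg_bregman (T : Type) (G : set_system T) {GG : Filter G}
    (p q : T -> 'rV[R]_n) u v :
  p @ G --> u -> q @ G --> v ->
  bregman h (p t) (q t) @[t --> G] --> bregman h u v.
Proof.
move=> pu qv; have hc w : {for w, continuous h} by exact: differentiable_continuous.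
apply: cvgB.
  by apply: cvgB; [exact: (cvg_comp _ _ pu (hc u))|exact: (cvg_comp _ _ qv (hc v))].
apply: (@cvg_dot _ _ _ _ _ (fun t => grad h (q t)) (fun t => p t - q t)).
  exact: (cvg_comp _ _ qv (@h_grad v)).
exact: cvgB.
Qed.

Lemma bregman_littleo x (e : R) : 0 < e ->
  \forall z \near x, bregman h z x <= e * `|z - x|.
Proof.
move=> e0.
have /eqaddoP/(_ e e0) := diff_locally (h_diff x).
rewrite (near_shift 0) subr0; apply: filterS => z /=.
rewrite addrK !fctE/= => /(le_trans (ler_norm _)).
suff -> : 'd h x z = dot (grad h x) z by rewrite /bregman addrK; lra.
rewrite [in LHS](row_sum_delta z) linear_sum/= /dot.
by apply: eq_bigr => i _; rewrite linearZ/= -deriveE// [grad _ _ _ _]mxE mulrC.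
Qed.

Lemma compact_norm_le (a : R) : compact [set u : 'rV[R]_n | `|u| <= a].
Proof.
apply: bounded_closed_compact.
  by exists a; split => [|b ab u /= /le_trans]; [exact: num_real|apply; exact: ltW].
apply: (@preimage_closed _ _ (fun u : 'rV[R]_n => `|u|) [set t | t <= a]).
  by move=> u _; exact: norm_continuous.
exact: closed_le.
Qed.

Hypothesis h_strict : forall x y, x != y ->
  h (2^-1 *: (x + y)) < (h x + h y) / 2.

(** By strict convexity, half of [bregman h z x] exceeds the Bregman distance from the midpoint to
    [x], which is nonnegative. *)
Lemma bregman_gt0 z x : z != x -> 0 < bregman h z x.
Proof.
move=> /h_strict; have := bregman_ge0 (2^-1 *: (z + x)) x.
rewrite /bregman.
have -> : 2^-1 *: (z + x) - x = 2^-1 *: (z - x).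
  rewrite -[in X in _ - X](scale1r x) scalerDr scalerBr -addrA -scalerBl -scaleNr.
  by congr (_ + _ *: _); lra.
rewrite dotZr; lra.
Qed.

(** For [x - z] on the sphere of radius [d], the values form a compact set missing 0, hence avoid a
    neighbourhood of 0, also when the sphere is empty. Larger distances reduce to the sphere by
    [bregman_segment]. *)
Lemma bregman_lower_bound (r d : R) : 0 < d ->
  exists2 m : R, 0 < m & forall z x, `|z| <= r -> d <= `|x - z| ->
    m <= bregman h z x.
Proof.
move=> d0.
have sph_compact : compact [set u : 'rV[R]_n | `|u| = d].
  apply: (subclosed_compact _ (@compact_norm_le d)); last by move=> u /= ->.
  apply: (@preimage_closed _ _ (fun u : 'rV[R]_n => `|u|) [set d]).
    by move=> u _; exact: norm_continuous.
  exact: closed_eq.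
pose D (p : 'rV[R]_n * 'rV[R]_n) := bregman h p.1 (p.1 + p.2).
have Dc : continuous D.
  move=> p; apply: cvg_bregman; first exact: cvg_fst.
  by apply: cvgD; [exact: cvg_fst|exact: cvg_snd].
have /(compact_closed (@Rhausdorff R)) img_closed :=
  continuous_compact (continuous_subspaceT Dc)
   (compact_setX (@compact_norm_le r) sph_compact).
have : nbhs (0 : R) (~` (D @` ([set u | `|u| <= r] `*` [set u | `|u| = d]))).
  apply: open_nbhs_nbhs; split; first exact: closed_openC.
  move=> [[z u] [/= _ ud] /eqP]; apply/negP; rewrite gt_eqF// bregman_gt0//.
  by rewrite -subr_eq0 opprD addNKr oppr_eq0 -normr_eq0 ud gt_eqF.
move=> /nbhs_ballP[m /= m0 mP]; exists m => // z x zr dx.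
pose s := d / `|x - z|.
have xz0 : 0 < `|x - z| by exact: lt_le_trans dx.
have s01 : 0 <= s <= 1 by rewrite /s ler_pdivrMr// mul1r dx divr_ge0// ltW.
have := @bregman_segment z (x - z) s s01; rewrite [z + (x - z)]addrC subrK.
apply: le_trans; rewrite leNgt; apply/negP => lem.
apply: (mP (bregman h z (z + s *: (x - z)))).
  by rewrite /ball/= sub0r normrN ger0_norm ?bregman_ge0.
exists (z, s *: (x - z)) => //=; split => //=.
by rewrite /s normrZ ger0_norm ?divfK ?gt_eqF// divr_ge0 ?ltW.
Qed.

(* [f] is the difference of the convex functions [L h + f] and [L h], and
   [L h + f] is a convex summand of the differentiable [2 L h]. *)
Variables (f : 'rV[R]_n -> R) (L : R).
Hypothesis L_ge0 : 0 <= L.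
Hypothesis convex_add : convex_fct (fun z => L * h z + f z).
Hypothesis convex_sub : convex_fct (fun z => L * h z - f z).

Lemma smooth_derivable x v : derivable f x v.
Proof.
have dLh : derivable (fun z => L * h z) x v.
  by apply: derivableM; [exact: derivable_cst|exact: diff_derivable].
have : derivable (fun z => L * h z + f z) x v.
  apply: (convex_summand_derivable convex_add convex_sub).
  rewrite (_ : (fun _ => _) = (fun z => L * h z) \+ (fun z => L * h z)).
    exact: derivableD.
  by apply/funext => z /=; lra.
move=> dp; rewrite (_ : f = (fun z => L * h z + f z) - (fun z => L * h z)).
  exact: derivableB.
by apply/funext => z; rewrite !fctE addrAC subrr add0r.
Qed.

(** The two sides of the bound are the gradient inequalities of [L h + f] and [L h - f]. *)
Lemma smooth_ineq z x :
  `|f z - f x - dot (grad f x) (z - x)| <= L * bregman h z x.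
Proof.
have dLh v : derivable (fun z => L * h z) x v.
  by apply: derivableM; [exact: derivable_cst|exact: diff_derivable].
have D1 v : 'D_v (fun z => L * h z) x = L * 'D_v h x.
  rewrite (_ : (fun _ => _) = L *: h)//.
  by rewrite deriveZ//; exact: diff_derivable.
have gp : grad (fun z => L * h z + f z) x = L *: grad h x + grad f x.
  by apply/rowP => i; rewrite !mxE deriveD ?D1//; exact: smooth_derivable.
have gm : grad (fun z => L * h z - f z) x = L *: grad h x - grad f x.
  by apply/rowP => i; rewrite !mxE deriveB ?D1//; exact: smooth_derivable.
have := @convex_grad_ineq R n _ x z convex_add.
move=> /(_ (fun i => derivableD (dLh _) (@smooth_derivable _ _))).
have := @convex_grad_ineq R n _ x z convex_sub.
move=> /(_ (fun i => derivableB (dLh _) (@smooth_derivable _ _))).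
rewrite gp gm dotBl dotDl !dotZl /bregman ler_norml; lra.
Qed.

(** Directional derivatives alone would not give continuity; in [smooth_ineq] both the Bregman term
    and the linear term vanish as [z] tends to [x]. *)
Lemma smooth_continuous : continuous f.
Proof.
move=> x; have xF : Filter (nbhs x) by exact: nbhs_filter.
apply/(@cvgrPdist_le _ R^o) => e e0.
have B0 : L * bregman h z x @[z --> x] --> 0.
  rewrite -[X in _ --> X](mulr0 L) (_ : 0 = bregman h x x).
    by apply: cvgMl_tmp; apply: cvg_bregman; [exact: cvg_id|exact: cvg_cst].
  by rewrite /bregman !subrr dot0r subr0.
have d0 : dot (grad f x) (z - x) @[z --> x] --> 0.
  rewrite -[X in _ --> X](dot0r (grad f x)) -(subrr x).
  by apply: cvg_dot; [exact: cvg_cst|apply: cvgB; [exact: cvg_id|exact: cvg_cst]].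
have e20 : 0 < e / 2 by rewrite divr_gt0.
move: B0 d0 => /cvgrPdist_le/(_ _ e20) B0 /cvgrPdist_le/(_ _ e20) d0.
near=> z.
have := smooth_ineq z x.
have : `|0 - L * bregman h z x| <= e / 2 by near: z.
have : `|0 - dot (grad f x) (z - x)| <= e / 2 by near: z.
by rewrite !ler_norml; lra.
Unshelve. all: end_near. Qed.

(* The difference quotients of [f] at [p t] in the direction [q t], of a fixed
   small step, are close to the derivatives uniformly in [t], by [smooth_ineq]. *)
Lemma cvg_smooth_deriv (T : Type) (G : set_system T) {GG : Filter G}
    (p q : T -> 'rV[R]_n) x u :
  p @ G --> x -> q @ G --> u ->
  dot (grad f (p t)) (q t) @[t --> G] --> dot (grad f x) u.
Proof.
move=> px qu; apply/cvgrPdist_le => e e0.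
(* In units of [e / 5 * s], the remainder at [x] costs one, the remainder at [p t] two, and the
   change in the increment of [f] one. In [c], adding 1 to [L] and to the norm of [u] keeps the
   divisor positive. *)
have [s s0 sP] : exists2 s : R, 0 < s & L * bregman h (x + s *: u) x <= e / 5 * s.
  pose c := e / 5 / ((L + 1) * (`|u| + 1)).
  have L1 : 0 < L + 1 by rewrite ltr_wpDl.
  have u1 : 0 < `|u| + 1 by rewrite ltr_wpDl.
  have c0 : 0 < c by rewrite !divr_gt0// mulr_gt0.
  have := bregman_littleo x c0.
  have : x + s *: u @[s --> (0 : R)^'+] --> x.
    rewrite -[X in _ --> X]addr0 -(scale0r u); apply: cvgD; first exact: cvg_cst.
    by apply: cvgZr_tmp; apply: cvg_at_right_filter; exact: cvg_id.
  move=> /[apply] H.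
  near ((0 : R)^'+) => s.
  have s0 : 0 < s by [].
  exists s => //.
  have : bregman h (x + s *: u) x <= c * `|x + s *: u - x| by near: s.
  rewrite addrAC subrr add0r normrZ gtr0_norm// => B.
  apply: (@le_trans _ _ ((L + 1) * (c * (s * `|u|)))).
    by rewrite ler_pM ?bregman_ge0// lerDl.
  have -> : e / 5 * s = (L + 1) * (c * (s * (`|u| + 1))).
    by rewrite /c; field; rewrite !gt_eqF.
  by rewrite !ler_pM2l// lerDl.
have ys : p t + s *: q t @[t --> G] --> x + s *: u.
  by apply: cvgD => //; exact: cvgZl_tmp.
have B : L * bregman h (p t + s *: q t) (p t) @[t --> G] -->
    L * bregman h (x + s *: u) x.
  by apply: cvgMl_tmp; exact: cvg_bregman.
have C : f (p t + s *: q t) - f (p t) @[t --> G] --> f (x + s *: u) - f x.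
  by apply: cvgB; [exact: (cvg_comp _ _ ys (@smooth_continuous _))|
    exact: (cvg_comp _ _ px (@smooth_continuous _))].
have es0 : 0 < e / 5 * s by rewrite !mulr_gt0.
move: B C => /cvgrPdist_le/(_ _ es0) B /cvgrPdist_le/(_ _ es0) C.
near=> t.
rewrite -(ler_pM2r s0) -{1}(gtr0_norm s0) -normrM.
have := smooth_ineq (p t + s *: q t) (p t).
have := smooth_ineq (x + s *: u) x.
have A y w : y + s *: w - y = s *: w by rewrite addrAC subrr add0r.
rewrite !A !dotZr.
have : `|L * bregman h (x + s *: u) x
    - L * bregman h (p t + s *: q t) (p t)| <= e / 5 * s by near: t.
have : `|f (x + s *: u) - f x - (f (p t + s *: q t) - f (p t))|
    <= e / 5 * s by near: t.
by rewrite !ler_norml; lra.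
Unshelve. all: end_near. Qed.

End Bregman.

(** * Limit points of sequences and distance to them *)

Section LimitPoints.
Variables (R : realType) (n : nat).
Implicit Types (p : 'rV[R]_n) (x y : nat -> 'rV[R]_n).

Lemma cvg_infty_ge (v : nat -> nat) : (forall k, (k <= v k)%N) -> v @ \oo --> \oo.
Proof.
move=> vk A [N _ NA]; exists N => // k /= Nk; apply: NA => /=.
exact: leq_trans (vk k).
Qed.

(** Indices [v k >= k] with [x (v k)] within [1 / (k + 1)] of [p] are chosen; [v] tends to infinity
    but need not increase. *)
Lemma cluster_subseq x p : cluster (x @ \oo) p ->
  exists2 v : nat -> nat, v @ \oo --> \oo & x \o v @ \oo --> p.
Proof.
move=> xp.
have /choice[v vP] : forall k, exists m, (k <= m)%N /\ ball p k.+1%:R^-1 (x m).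
  move=> k.
  have [||_ [[m /= km <-] pm]] := xp (x @` [set m | (k <= m)%N]) (ball p k.+1%:R^-1).
  - by exists k => // m /= km; exists m.
  - exact: nbhsx_ballx.
  - by exists m.
exists v; first by apply: cvg_infty_ge => k; have [] := vP k.
apply/cvg_ballP => e e0; near=> k.
apply: (@le_ball _ _ _ k.+1%:R^-1); last by have [] := vP k.
by apply: ltW; near: k; exact: near_infty_natSinv_lt (PosNum e0).
Unshelve. all: end_near. Qed.

Lemma subseq_cluster x p (v : nat -> nat) :
  v @ \oo --> \oo -> cluster (x \o v @ \oo) p -> cluster (x @ \oo) p.
Proof. by move=> vy xvp A B xA pB; exact: xvp (vy _ xA) pB. Qed.

Lemma cluster_cvg_diff x y : x k - y k @[k --> \oo] --> (0 : 'rV[R]_n) ->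
  cluster (x @ \oo) `<=` cluster (y @ \oo).
Proof.
move=> xy p /cluster_subseq[v vy xvp]; apply: (subseq_cluster vy).
have yvp : y \o v @ \oo --> p.
  have -> : y \o v = (x \o v) \- ((fun k => x k - y k) \o v).
    by apply/funext => k /=; rewrite opprB addrC subrK.
  rewrite -[X in _ --> X]subr0; apply: (cvgB xvp); exact: (cvg_comp _ _ vy xy).
move=> A B yA pB.
exact: filter_ex (filterI yA (yvp _ pB)).
Qed.

(** Otherwise infinitely many terms avoid [U]; by compactness they accumulate at a limit point of
    [x], near which every point is in [U]. *)
Lemma cluster_near x (K U : set 'rV[R]_n) : compact K -> (forall k, K (x k)) ->
  (forall p, cluster (x @ \oo) p -> nbhs p U) -> \forall k \near \oo, U (x k).
Proof.
move=> cK Kx clU; apply: contrapT => nU.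
have /choice[v vP] : forall k, exists m, (k <= m)%N /\ ~ U (x m).
  move=> k; apply: contrapT => /forallNP H; apply: nU; exists k => // m /= km.
  by apply: contrapT => Um; apply: (H m).
have vy : v @ \oo --> \oo by apply: cvg_infty_ge => k; have [] := vP k.
have [p [_ xvp]] : (K `&` cluster (x \o v @ \oo)) !=set0.
  by apply: cK; exists 0%N => // k _; exact: Kx.
have pU := clU _ (subseq_cluster vy xvp).
have [|z [/= nUz Uz]] := xvp (~` U) U _ pU; last exact: nUz.
by exists 0%N => // k _; have [] := vP k.
Qed.

Lemma closed_cluster (F : set_system 'rV[R]_n) : closed (cluster F).
Proof. by rewrite clusterE; apply: closed_bigI => A _; exact: closed_closure. Qed.

Lemma compact_cluster x (K : set 'rV[R]_n) : compact K -> (forall k, K (x k)) ->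
  compact (cluster (x @ \oo)).
Proof.
move=> cK Kx; apply: (subclosed_compact (@closed_cluster _) cK).
rewrite clusterE => p /(_ K); rewrite -(closure_id K).1.
  by apply; exists 0%N => // k _; exact: Kx.
exact: compact_closed (@norm_hausdorff _ _) cK.
Qed.

Lemma norm_le_enorm (u : 'rV[R]_n) : `|u| <= enorm u.
Proof.
rewrite [`|u|]mx_normrE; apply: bigmax_le => [|[i j] _] /=; first exact: sqrtr_ge0.
rewrite -sqrtr_sqr ler_wsqrtr// ord1 /dot (bigD1 j)//= -expr2 lerDl.
by rewrite sumr_ge0// => k _; rewrite -expr2 sqr_ge0.
Qed.

Lemma enorm_near p (e : R) : 0 < e -> \forall z \near p, enorm (z - p) <= e.
Proof.
move=> e0.
have pF : Filter (nbhs p) by exact: nbhs_filter.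
have : enorm (z - p) @[z --> p] --> enorm (0 : 'rV[R]_n).
  have zp : z - p @[z --> p] --> (0 : 'rV[R]_n).
    by rewrite -(subrr p); apply: cvgB; [exact: cvg_id|exact: cvg_cst].
  exact: (cvg_comp _ _ (cvg_dot zp zp) (@sqrt_continuous _ _)).
rewrite {2}/enorm dot0r sqrtr0 => /(@cvgrPdist_le _ R^o)/(_ _ e0).
by apply: filterS => z; rewrite sub0r normrN => /(le_trans (ler_norm _)).
Qed.

Lemma edist_cluster_cvg x (K : set 'rV[R]_n) : compact K -> (forall k, K (x k)) ->
  edist_set (x k) (cluster (x @ \oo)) @[k --> \oo] --> 0%E.
Proof.
move=> cK Kx; set W := cluster _.
have ge0 k : (0 <= edist_set (x k) W)%E.
  by apply: le_ereal_inf_tmp => _ [w _ <-]; rewrite lee_fin sqrtr_ge0.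
have small (e : R) : 0 < e -> \forall k \near \oo, (edist_set (x k) W <= e%:E)%E.
  move=> e0.
  (* The points within [e] of some limit point form a neighbourhood of every limit point. *)
  have : \forall k \near \oo, [set z | exists2 w, W w & enorm (z - w) <= e] (x k).
    apply: (cluster_near cK Kx) => p Wp.
    by apply: filterS (enorm_near p e0) => z zp; exists p.
  apply: filterS => k [w Ww we].
  by apply: (@le_trans _ _ (enorm (x k - w))%:E); [apply: ereal_inf_lbound; exists w|].
apply/fine_cvgP; split.
  apply: filterS (small 1 ltr01) => k k1.
  by rewrite ge0_fin_numE// (le_lt_trans k1)// ltry.
apply/cvgrPdist_le => e e0; apply: filterS (small e e0) => k ke /=.
have kfin : edist_set (x k) W \is a fin_num.
  by rewrite ge0_fin_numE// (le_lt_trans ke)// ltry.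
by rewrite sub0r normrN ger0_norm ?fine_ge0// -lee_fin fineK.
Qed.

End LimitPoints.

(** * The forward-backward model, its fixed points and its limits *)

Section ForwardBackward.
Variables (R : realType) (n : nat).
Implicit Types (w x y z : 'rV[R]_n).
Variables (h f : 'rV[R]_n -> R) (g : 'rV[R]_n -> \bar R) (L gamma : R).
Hypothesis h_convex : convex_fct h.
Hypothesis h_diff : forall x, differentiable h x.
Hypothesis h_grad : continuous (grad h).
Hypothesis L_ge0 : 0 <= L.
Hypothesis convex_add : convex_fct (fun z => L * h z + f z).
Hypothesis convex_sub : convex_fct (fun z => L * h z - f z).
Hypothesis gamma_gt0 : 0 < gamma.
Hypothesis g_proper : eproper g.
Hypothesis g_lsc : lower_semicontinuous g.
Hypothesis h_strict : forall x y, x != y ->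
  h (2^-1 *: (x + y)) < (h x + h y) / 2.

Let phi z : \bar R := ((f z)%:E + g z)%E.
Let model := bfb_model h f g gamma.
Let env := bfb_env h f g gamma.
Let smooth := smooth_ineq h_diff convex_add convex_sub.

(** Replacing the linearization of [f] by [f z] costs at most [L * bregman h z x] either way; here
    and in [model_le] this shifts the coefficient [gamma^-1] by [L]. *)
Lemma model_ge x z :
  (phi z + ((gamma^-1 - L) * bregman h z x)%:E <= model x z)%E.
Proof.
rewrite /model /phi /bfb_model; case: (g z) => [c| |]//.
rewrite -!EFinD lee_fin; have := smooth z x; rewrite ler_norml; lra.
Qed.

Lemma model_le x z :
  (model x z <= phi z + ((gamma^-1 + L) * bregman h z x)%:E)%E.
Proof.
rewrite /model /phi /bfb_model; case: (g z) => [c| |]//.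
rewrite -!EFinD lee_fin; have := smooth z x; rewrite ler_norml; lra.
Qed.

Lemma model_diag x : model x x = phi x.
Proof. by rewrite /model /bfb_model /bregman !subrr !dot0r !subr0 addr0 mulr0 adde0. Qed.

Lemma env_le x z : (env x <= model x z)%E.
Proof. by apply: ereal_inf_lbound; exists z. Qed.

Lemma env_bfb_map x z : bfb_map h f g gamma x z -> env x = model x z.
Proof.
move=> xz; apply/eqP; rewrite eq_le env_le /=.
by apply: le_ereal_inf_tmp => _ [y _ <-]; exact: xz.
Qed.

Lemma fixed_point_stationary x : bfb_map h f g gamma x x -> stationary phi x.
Proof.
move=> xT; have [gNy [z0 gz0]] := g_proper.
have gx : g x \is a fin_num.
  have := xT z0; rewrite -/(model x x) model_diag /phi /bfb_model.
  move: gz0 (gNy x) (gNy z0); rewrite /edom/=.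
  by case: (g z0) (g x) => [c| |] [d| |].
have phix : phi x \is a fin_num by rewrite fin_numD gx.
have regular : regular_subdiff phi x 0.
  split=> // e e0.
  have c0 : 0 < gamma^-1 + L by rewrite ltr_pwDl ?invr_gt0.
  (* The accuracy is chosen so that the Bregman term of [model_le] is at most [e] times the norm of
     [z - x]. *)
  have := bregman_littleo h_diff x (divr_gt0 e0 c0).
  apply: filterS => z; rewrite dot0l sub0r => zB.
  have {zB} : (gamma^-1 + L) * bregman h z x <= e * enorm (z - x).
    rewrite -ler_pdivlMl//; apply: (le_trans zB).
    by rewrite mulrA [_^-1 * e]mulrC ler_pM2l ?divr_gt0// norm_le_enorm.
  have := le_trans (xT z) (model_le x z); rewrite -/(model x x) model_diag.
  move: phix; case: (phi x) => // a _; case: (phi z) => [b| |]//.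
    rewrite -!EFinD !lee_fin; lra.
  by move=> _ _; rewrite leey.
split=> //; exists (fun=> x), (fun=> 0); split => //; exact: cvg_cst.
Qed.

(** If [g y] exceeded [c + e], so would [g] near [y], yet eventually [b k <= c + e]. *)
Lemma lsc_le_lim (z : nat -> 'rV[R]_n) y (b : nat -> R) (c : R) :
  z @ \oo --> y -> b @ \oo --> c -> (forall k, (g (z k) <= (b k)%:E)%E) ->
  (g y <= c%:E)%E.
Proof.
move=> zy bc gb; apply/lee_addgt0Pr => e e0.
rewrite leNgt; apply/negP => /g_lsc[V yV gV].
have /cvgrPdist_le/(_ e e0) be := bc.
have zV : \forall k \near \oo, V (z k) by exact: zy.
have [k [Vk]] := filter_ex (filterI zV be).
have := lt_le_trans (gV _ Vk) (gb k).
rewrite lte_fin ler_norml; lra.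
Qed.

Lemma cvg_smooth_model (p : nat -> 'rV[R]_n) y z : p @ \oo --> y ->
  f (p k) + dot (grad f (p k)) (z - p k) + gamma^-1 * bregman h z (p k)
    @[k --> \oo] --> f y + dot (grad f y) (z - y) + gamma^-1 * bregman h z y.
Proof.
move=> py; apply: cvgD; last first.
  by apply: cvgMl_tmp; apply: (cvg_bregman h_diff h_grad) => //; exact: cvg_cst.
have fc := smooth_continuous h_diff h_grad convex_add convex_sub.
apply: cvgD; first exact: (cvg_comp _ _ py (fc y)).
apply: (cvg_smooth_deriv h_convex h_diff h_grad L_ge0 convex_add convex_sub) => //.
by apply: cvgB => //; exact: cvg_cst.
Qed.

(** Moving the continuous [f] to the right bounds [g (q k)] by a convergent real sequence, to which
    [lsc_le_lim] applies. *)
Lemma phi_le_model_lim (p q : nat -> 'rV[R]_n) y z :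
  p @ \oo --> y -> q @ \oo --> y ->
  (forall k, (phi (q k) <= model (p k) z)%E) -> (phi y <= model y z)%E.
Proof.
move=> py qy; rewrite /phi /model /bfb_model.
case: (g z) (g_proper.1 z) => [c| |]// _; last by rewrite leey.
move=> H.
have fc := smooth_continuous h_diff h_grad convex_add convex_sub.
have M := @cvg_smooth_model p y z py.
have : (g y <= (f y + dot (grad f y) (z - y) + gamma^-1 * bregman h z y
    + c - f y)%:E)%E.
  pose b k := f (p k) + dot (grad f (p k)) (z - p k)
    + gamma^-1 * bregman h z (p k) + c - f (q k).
  apply: (@lsc_le_lim q y b) => // [|k].
    apply: cvgB; last exact: (cvg_comp _ _ qy (fc y)).
    by apply: cvgD; [exact: M|exact: cvg_cst].
  move: (H k); rewrite -!EFinD; case: (g (q k)) => [d| |]//.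
    by rewrite -EFinD !lee_fin /b; lra.
  by move=> _; rewrite leNye.
case: (g y) => [d| |]//; first by rewrite -!EFinD !lee_fin; lra.
by move=> _; rewrite leNye.
Qed.

(** * Sequences along which the envelope descends *)

Variables (sigma : R) (x xb : nat -> 'rV[R]_n).
Hypothesis sigma_gt0 : 0 < sigma.
Hypothesis phi_argmin : argmin phi !=set0.
Hypothesis phi_level : level_bounded phi.
Hypothesis xb_map : forall k, bfb_map h f g gamma (x k) (xb k).
Hypothesis env_descent : forall k,
  (env (x k.+1) <= env (x k) - (sigma * bregman h (xb k) (x k))%:E)%E.
Hypothesis L_lt : L < gamma^-1.

(** A minimizer could a priori have value [+oo]; comparison with a point where [g] is finite
    excludes this. *)
Lemma phi_argmin_fin : exists2 m : R, (exists z, phi z = m%:E) &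
  forall z, (m%:E <= phi z)%E.
Proof.
have [z0 z0P] := phi_argmin; have [gNy [z1 gz1]] := g_proper.
have : phi z0 \is a fin_num.
  have := z0P z1; rewrite /phi; move: gz1 (gNy z0) (gNy z1); rewrite /edom/=.
  by case: (g z0) (g z1) => [c| |] [d| |].
move=> /fineK phi0; exists (fine (phi z0)); first by exists z0.
by move=> z; rewrite phi0; exact: z0P.
Qed.

Lemma phi_le_env k : (phi (xb k) <= env (x k))%E.
Proof.
rewrite (env_bfb_map (xb_map k)); apply: le_trans (model_ge _ _).
rewrite leeDl// lee_fin; apply: mulr_ge0; first by rewrite subr_ge0 ltW.
exact: bregman_ge0.
Qed.

(** The minimum of [phi] bounds the envelope below, the model at a minimizer bounds it above. *)
Lemma env_xE k : env (x k) = (fine (env (x k)))%:E.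
Proof.
have [m [z0 z0m] mle] := phi_argmin_fin.
have menv := le_trans (mle _) (phi_le_env k).
rewrite fineK// fin_numElt (lt_le_trans (ltNyr m) menv)/=.
apply: (le_lt_trans (env_le _ z0)); apply: (le_lt_trans (model_le _ _)).
by rewrite z0m -EFinD ltry.
Qed.

Lemma phi_xbE k : phi (xb k) = (fine (phi (xb k)))%:E.
Proof.
have [m _ mle] := phi_argmin_fin.
rewrite fineK// fin_numElt (lt_le_trans (ltNyr m) (mle _))/=.
by apply: (le_lt_trans (phi_le_env k)); rewrite env_xE ltry.
Qed.

Let D k := bregman h (xb k) (x k).
Let e k := fine (env (x k)).
Let p k := fine (phi (xb k)).

Lemma fine_phi_le_env k : p k <= e k.
Proof. by rewrite -lee_fin -env_xE -phi_xbE phi_le_env. Qed.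

Lemma fine_env_le_phi k : e k <= p k + (gamma^-1 + L) * D k.
Proof.
rewrite -lee_fin EFinD -env_xE -phi_xbE (env_bfb_map (xb_map k)).
exact: model_le.
Qed.

Lemma fine_env_descent k : e k.+1 <= e k - sigma * D k.
Proof. by rewrite -lee_fin EFinB -!env_xE; exact: env_descent. Qed.

Lemma bregman_xb_x_ge0 k : 0 <= D k. Proof. exact: bregman_ge0. Qed.

Lemma env_cvg : exists l : R, e @ \oo --> l.
Proof.
have [m _ mle] := phi_argmin_fin.
exists (inf (range e)); apply: nonincreasing_cvgn.
  apply/nonincreasing_seqP => k; apply: le_trans (fine_env_descent k) _.
  by rewrite lerBlDr lerDl mulr_ge0 ?bregman_xb_x_ge0// ltW.
exists m => _ [k _ <-]; apply: le_trans (fine_phi_le_env k).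
by rewrite -lee_fin -phi_xbE.
Qed.

(** Descent bounds [D k] by [(e k - e k.+1) / sigma], and [e] converges. *)
Lemma bregman_xb_x_cvg0 : D @ \oo --> (0 : R).
Proof.
have [l el] := env_cvg.
have eSl : (fun k => e k.+1) @ \oo --> l by rewrite cvg_shiftS.
apply: (@squeeze_cvgr _ _ _ _ (fun=> 0) (fun k => (e k - e k.+1) / sigma)).
- apply: nearW => k; rewrite bregman_xb_x_ge0/= ler_pdivlMr// mulrC.
  by have := fine_env_descent k; lra.
- exact: cvg_cst.
- rewrite -[X in _ --> X](mul0r sigma^-1) -(subrr l).
  by apply: cvgMr_tmp; exact: cvgB.
Qed.

Lemma phi_xb_cvg (l : R) : e @ \oo --> l -> p @ \oo --> l.
Proof.
move=> el.
apply: (@squeeze_cvgr _ _ _ _ (fun k => e k - (gamma^-1 + L) * D k) e) => //.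
  by apply: nearW => k; rewrite fine_phi_le_env andbT; have := fine_env_le_phi k; lra.
rewrite -[X in _ --> X]subr0 -[X in _ - X](mulr0 (gamma^-1 + L)).
by apply: cvgB => //; apply: cvgMl_tmp; exact: bregman_xb_x_cvg0.
Qed.

(** All [xb k] lie in the sublevel set of [phi] at the initial envelope value. This argument does
    not reach [x k], where [phi] may be infinite. *)
Lemma xb_bounded : exists r, forall k, `|xb k| <= r.
Proof.
have [M [_ HM]] := phi_level (e 0%N).
exists (M + 1) => k; apply: HM; first by rewrite ltrDl.
rewrite /= phi_xbE lee_fin; apply: le_trans (fine_phi_le_env k) _.
elim: k => // k; apply: le_trans; apply: le_trans (fine_env_descent k) _.
by rewrite lerBlDr lerDl mulr_ge0 ?bregman_xb_x_ge0// ltW.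
Qed.

Lemma x_sub_xb_cvg0 : x k - xb k @[k --> \oo] --> (0 : 'rV[R]_n).
Proof.
have [r xbr] := xb_bounded.
apply/cvgrPdist_lt => d d0.
(* Only the first argument [xb k] must stay in a ball, so boundedness of [x] can be deduced
   afterwards. *)
have [m m0 mP] := bregman_lower_bound h_convex h_diff h_grad h_strict r d0.
have /cvgrPdist_lt/(_ m m0) := bregman_xb_x_cvg0.
apply: filterS => k; rewrite sub0r normrN ger0_norm ?bregman_xb_x_ge0// => Dm.
rewrite sub0r normrN ltNge; apply/negP => dx.
by have := mP _ _ (xbr k) dx; rewrite leNgt Dm.
Qed.

Lemma xb_sub_x_cvg0 : xb k - x k @[k --> \oo] --> (0 : 'rV[R]_n).
Proof.
rewrite -[X in _ --> X]oppr0.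
under eq_fun => k do rewrite -opprB.
exact: cvgN x_sub_xb_cvg0.
Qed.

Lemma x_bounded : exists r, forall k, `|x k| <= r.
Proof.
have [r xbr] := xb_bounded.
have /cvg_seq_bounded[M [_ HM]] : cvgn (fun k => x k - xb k).
  by apply/cvg_ex; exists 0; exact: x_sub_xb_cvg0.
exists (M + 1 + r) => k; rewrite -(subrK (xb k) (x k)).
apply: le_trans (ler_normD _ _) _; rewrite lerD//.
by apply: (HM (M + 1)) => //; rewrite ltrDl.
Qed.

Lemma cluster_xbE : cluster (xb @ \oo) = cluster (x @ \oo).
Proof.
apply/seteqP; split; apply: cluster_cvg_diff.
  exact: xb_sub_x_cvg0.
exact: x_sub_xb_cvg0.
Qed.

Lemma cluster_fixed_value (l : R) y : e @ \oo --> l -> cluster (x @ \oo) y ->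
  bfb_map h f g gamma y y /\ phi y = l%:E.
Proof.
move=> el /cluster_subseq[v vy xvy].
have xbvy : xb \o v @ \oo --> y.
  have -> : xb \o v = (x \o v) \+ ((fun k => xb k - x k) \o v).
    by apply/funext => k /=; rewrite addrC subrK.
  rewrite -[X in _ --> X]addr0; apply: (cvgD xvy).
  exact: (cvg_comp _ _ vy xb_sub_x_cvg0).
have fixed : bfb_map h f g gamma y y.
  move=> z; rewrite -/(model y y) -/(model y z) model_diag.
  apply: (phi_le_model_lim xvy xbvy) => k /=.
  exact: le_trans (phi_le_env _) (env_le _ _).
split=> //; apply/eqP; rewrite eq_le; apply/andP; split.
  (* Upper bound: [phi (xb (v k)) <= e (v k)] passes to the limit by lower semicontinuity of [g]. *)
  have fc := smooth_continuous h_diff h_grad convex_add convex_sub.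
  have : (g y <= (l - f y)%:E)%E.
    apply: (@lsc_le_lim _ _ (fun k => e (v k) - f (xb (v k))) _ xbvy) => [|k].
      by apply: cvgB; [exact: (cvg_comp _ _ vy el)|exact: (cvg_comp _ _ xbvy (fc y))].
    have := fine_phi_le_env (v k); rewrite -lee_fin -phi_xbE /phi /=.
    by case: (g _) => [d| |]//;
    [rewrite -EFinD !lee_fin; lra|by move=> _; rewrite leNye].
  by rewrite /phi; case: (g y) => [d| |]//;
    [rewrite -EFinD !lee_fin; lra|by move=> _; rewrite leNye].
(* Lower bound: [e (v k)] is at most the model based at [x (v k)] and evaluated at [y], which tends
   to [phi y]; finiteness of [phi y] comes first, from the fixed-point inclusion. *)
have : (phi y < +oo)%E.
  have [m [z0 z0m] _] := phi_argmin_fin.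
  rewrite -model_diag; apply: (le_lt_trans (fixed z0)).
  by apply: (le_lt_trans (model_le _ _)); rewrite z0m -EFinD ltry.
have M := @cvg_smooth_model _ y y xvy.
have B0 : bregman h y y = 0 by rewrite /bregman !subrr dot0r subr0.
rewrite subrr dot0r B0 mulr0 !addr0 in M.
case gy : (g y) (g_proper.1 y) => [d| |]// _; last by rewrite /phi gy.
rewrite /phi gy -EFinD lee_fin => _.
apply: (@ler_cvg_to _ _ _ _ (e \o v) _ _ _ (cvg_comp _ _ vy el)
  (cvgD M (cvg_cst d))).
apply: nearW => k /=; rewrite -lee_fin -env_xE.
apply: le_trans (env_le _ y) _.
rewrite /model /bfb_model gy -!EFinD lee_fin !fctE; lra.
Qed.

(** The line search enters only through [env_descent], so the choice of directions and of [imax] is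
    irrelevant here. *)
Lemma envelope_descent_limit_points :
  let omega := cluster (x @ \oo) in
  [/\ cluster (xb @ \oo) = omega,
      compact omega,
      edist_set (x k) omega @[k --> \oo] --> 0%E &
      edist_set (xb k) omega @[k --> \oo] --> 0%E] /\
  (forall y, omega y -> bfb_map h f g gamma y y /\ stationary phi y) /\
  (exists l : R,
    [/\ phi (xb k) @[k --> \oo] --> l%:E,
        env (x k) @[k --> \oo] --> l%:E &
        forall y, omega y -> phi y = l%:E]).
Proof.
have [l el] := env_cvg; have [r xr] := x_bounded; have [rb xbr] := xb_bounded.
split; last split.
- split; first exact: cluster_xbE.
  + exact: (compact_cluster (@compact_norm_le _ _ r)).
  + exact: (edist_cluster_cvg (@compact_norm_le _ _ r)).
  + by rewrite -cluster_xbE; exact: (edist_cluster_cvg (@compact_norm_le _ _ rb)).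
- move=> y /(cluster_fixed_value el)[fixed _].
  by split=> //; exact: fixed_point_stationary.
- exists l; split; last by move=> y /(cluster_fixed_value el)[].
  + under eq_fun do rewrite phi_xbE.
    by apply: cvg_EFin; [exact: nearW|exact: phi_xb_cvg].
  + under eq_fun do rewrite env_xE.
    by apply: cvg_EFin; [exact: nearW|exact: el].
Qed.

End ForwardBackward.

(** * Real-valued consequences of the Legendre kernel axioms *)

Section Legendre.
Variables (R : realType) (n : nat).
Implicit Types (h f : 'rV[R]_n -> R).

Lemma convex_function_fct f :
  convex_function (E := 'rV[R]_n) setT f -> convex_fct f.
Proof.
move=> cf x y t /andP[t0 t1].
have t01 : 0 <= t <= 1 by rewrite !ltW.
by have := cf (Itv01 (ltW t0) (ltW t1)) x y; rewrite !inE => /(_ I I).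
Qed.

Lemma legendre_kernel_convex h :
  legendre_kernel (fun z => (h z)%:E) -> convex_fct h.
Proof.
move=> /legendre_convex H x y t t01.
by have := H x y t t01; rewrite -!EFinM -EFinD lee_fin.
Qed.

Lemma legendre_kernel_strict h x y : legendre_kernel (fun z => (h z)%:E) ->
  x != y -> h (2^-1 *: (x + y)) < (h x + h y) / 2.
Proof.
move=> /legendre_strict H xy.
have := H x y 2^-1 (ltry _) (ltry _) xy.
have -> : 1 - 2^-1 = 2^-1 :> R by lra.
rewrite -!EFinM -EFinD lte_fin -scalerDr => /(_ _)/lt_le_trans; apply; lra.
Qed.

Lemma legendre_kernel_diff h x : legendre_kernel (fun z => (h z)%:E) ->
  differentiable h x /\ {for x, continuous (grad h)}.
Proof.
move=> /legendre_C1/(_ x); apply.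
have -> : edom (fun z => (h z)%:E) = setT.
  by apply/seteqP; split => // z _; rewrite /edom/= ltry.
by rewrite interiorT.
Qed.

End Legendre.

Theorem theorem5p4 (R : realType) (n : nat)
  (h f : 'rV[R]_n -> R) (g : 'rV[R]_n -> \bar R) (Lf gamma sigma : R)
  (imax : option nat) (x xb : nat -> 'rV[R]_n)
  (hh : legendre_kernel (fun z => (h z)%:E))
  (hf : rel_smooth Lf h f)
  (hg_proper : eproper g)
  (hg_lsc : lower_semicontinuous g)
  (hargmin : argmin (fun z => ((f z)%:E + g z)%E) !=set0)
  (hgamma : 0 < gamma) (hgammaL : (gamma%:E < (Lf%:E)^-1)%E)
  (hsigma : 0 < sigma < (1 - gamma * Lf) / gamma)
  (hrun : bella h f g gamma sigma 0 imax x xb)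
  (hneq : forall k : nat, xb k <> x k)
  (hlevel : level_bounded (fun z => ((f z)%:E + g z)%E)) :
  let phi : 'rV[R]_n -> \bar R := fun z => ((f z)%:E + g z)%E in
  let omega : set 'rV[R]_n := cluster (x @ \oo) in
  [/\ cluster (xb @ \oo) = omega,
      compact omega,
      edist_set (x k) omega @[k --> \oo] --> 0%E &
      edist_set (xb k) omega @[k --> \oo] --> 0%E] /\
  (forall xs, omega xs ->
     bfb_map h f g gamma xs xs /\ stationary phi xs) /\
  (exists phis : R,
    [/\ phi (xb k) @[k --> \oo] --> phis%:E,
        bfb_env h f g gamma (x k) @[k --> \oo] --> phis%:E &
        forall xs, omega xs -> phi xs = phis%:E]).
Proof.
have h_convex := legendre_kernel_convex hh.
have h_diff z : differentiable h z by have [] := legendre_kernel_diff z hh.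
have h_grad : continuous (grad h) by move=> z; have [_] := legendre_kernel_diff z hh.
have h_strict u v := @legendre_kernel_strict _ _ h u v hh.
have [L_ge0 /convex_function_fct cadd /convex_function_fct csub] := hf.
have [sigma_gt0 sigma_lt] := andP hsigma.
have sL : sigma < gamma^-1 - Lf.
  by rewrite mulrBl mul1r mulrAC divff ?mul1r ?gt_eqF// in sigma_lt.
(* As [xb k] differs from [x k], the stopping test with tolerance 0 never succeeds, so [bella]
   constrains every iteration. *)
have running k : ~ (bregman h (xb k) (x k) <= 0).
  by apply/negP; rewrite -ltNge bregman_gt0//; exact/eqP.
have xb_map k : bfb_map h f g gamma (x k) (xb k) 
  by have [] := hrun k (fun j _ => running j).
have L_lt : Lf < gamma^-1 by lra.
have descent k : (bfb_env h f g gamma (x k.+1) <= bfb_env h f g gamma (x k)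
    - (sigma * bregman h (xb k) (x k))%:E)%E.
  have [_ /(_ (running k))[d [[i [_ acc _ ->]]|[m [_ _ ->]]]]] :=
    hrun k (fun j _ => running j); first exact: acc.
  (* Fallback step: [env (xb k) <= phi (xb k)], which by [model_ge] is at most [env (x k)] less
     [(gamma^-1 - Lf)] times the Bregman distance; [sL] concludes. *)
  apply: le_trans (env_le _ _ _ _ _ (xb k)) _; rewrite model_diag.
  rewrite leeBrDr// (env_bfb_map (xb_map k)).
  apply: le_trans (model_ge _ _ h_diff cadd csub _ _).
  by rewrite leeD2l// lee_fin ler_wpM2r ?bregman_ge0// ltW.
exact: (envelope_descent_limit_points h_convex h_diff h_grad L_ge0 cadd csub hgamma
  hg_proper hg_lsc h_strict sigma_gt0 hargmin hlevel xb_map descent L_lt).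
Qed.
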